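(* Let $D$ be a division ring of characteristic different from $2$ and let $n$ be a positive integer. If $D$ is not the field of three elements, then every matrix in $\mathrm{M}_n(D)$ is expressible as a product of two diagonalizable matrices in $\mathrm{M}_n(D)$. Moreover, the number $2$ is sharp: it cannot in general be replaced by $1$, i.e. there exist such a $D$, a positive integer $n$, and a matrix in $\mathrm{M}_n(D)$ that is not diagonalizable.
   Context: $\mathrm{M}_n(D)$ is the ring of $n\times n$ matrices over $D$. A square matrix over $D$ is diagonalizable if it is similar over $D$ (conjugate by an invertible matrix over $D$) to a diagonal matrix with entries in $D$. Division rings may be commutative or noncommutative. *)

(* Defs.v *)
From HB Require Import structures.
From mathcomp Require Import all_boot all_order all_algebra.

Set Implicit Arguments.
Unset Strict Implicit.
Unset Printing Implicit Defensive.

Import GRing.Theory.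
Local Open Scope ring_scope.

(* Nontriviality, 1 != 0, is part of unitRingType; multiplication need not be
   commutative. *)
Definition division_ring (D : unitRingType) : Prop :=
  forall x : D, x != 0 -> x \is a GRing.unit.

Definition is_field_of_three_elements (D : unitRingType) : Prop :=
  exists f : {rmorphism 'F_3 -> D}, bijective f.

(* unitmx, and hence the library's similar and diagonalizable, require
   commutative coefficients; the definitions below work over any ring. *)
Definition inverse_mx (D : unitRingType) (n : nat) (P Q : 'M[D]_n) : Prop :=
  P *m Q = 1%:M /\ Q *m P = 1%:M.

Definition similar_mx (D : unitRingType) (n : nat) (A B : 'M[D]_n) : Prop :=
  exists P Q : 'M[D]_n, inverse_mx P Q /\ A = P *m B *m Q.

Definition diagonalizable_mx (D : unitRingType) (n : nat) (A : 'M[D]_n) :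
    Prop :=
  exists d : 'rV[D]_n, similar_mx A (diag_mx d).

(* Main.v *)
Require Import Defs.
From Stdlib Require Import Classical_Prop.
From HB Require Import structures.
From mathcomp Require Import all_boot all_order all_algebra perm zify.

Set Implicit Arguments.
Unset Strict Implicit.
Unset Printing Implicit Defensive.

Import GRing.Theory.
Local Open Scope ring_scope.

(* Every matrix is similar to a direct sum of companion matrices, so it is
   enough to factor a companion matrix C of size n > 1, with constant
   coefficient c in the first entry of its last row.  Let J reverse the order
   of the basis, except that the last basis vector goes to
   (1 + a) e_last - a e_first.  Then J has the eigenvalue a and is an involution
   modulo that eigenvector, while C J^-1 reverses the first n - 1 basis vectors
   and has the remaining eigenvalue - c a^-1.  The eigenvalues 1 and -1 of an
   involution are central, so any eigenvalue whose square is not 1 splits off,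
   and both factors are diagonalizable as soon as a <> 0, c, -c and either
   a = -1 or a^2 <> 1.  If c is not 1 or -1, take a = -1; otherwise take for a
   any element other than 0, 1, -1, which exists because D is not the field of
   three elements. *)

(** * Completing free rows to a basis *)

(** Rectangular, so that a change of basis can be indexed by [n] on one side and by [k + m] on the
    other, sizes that are equal without being convertible. For [p = q] this is [inverse_mx]. *)
Definition mutual_inverse_mx (D : unitRingType) (p q : nat)
    (P : 'M[D]_(p, q)) (Q : 'M[D]_(q, p)) : Prop :=
  P *m Q = 1%:M /\ Q *m P = 1%:M.

Definition free_rows (D : unitRingType) (k n : nat) (K : 'M[D]_(k, n)) : Prop :=
  forall u : 'rV[D]_k, u *m K = 0 -> u = 0.

Lemma mutual_inverse_mxM (D : unitRingType) (p q r : nat)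
    (P : 'M[D]_(p, q)) P' (R : 'M[D]_(q, r)) R' :
  mutual_inverse_mx P P' -> mutual_inverse_mx R R' ->
  mutual_inverse_mx (P *m R) (R' *m P').
Proof.
move=> [PP' P'P] [RR' R'R]; split.
  by rewrite mulmxA -(mulmxA P) RR' mulmx1.
by rewrite mulmxA -(mulmxA R') P'P mulmx1.
Qed.

Lemma mutual_inverse_lblock (D : unitRingType) (p q r s : nat)
    (P : 'M[D]_(p, q)) P' (R : 'M[D]_(r, s)) R' (X : 'M_(r, q)) :
  mutual_inverse_mx P P' -> mutual_inverse_mx R R' ->
  mutual_inverse_mx (block_mx P 0 X R) (block_mx P' 0 (- (R' *m X *m P')) R').
Proof.
move=> [PP' P'P] [RR' R'R]; split; rewrite mulmx_block.
  rewrite !mulmx0 !mul0mx !addr0 PP' add0r RR' mulmxN !mulmxA RR' mul1mx subrr.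
  by rewrite -scalar_mx_block.
rewrite !mulmx0 !mul0mx !addr0 P'P add0r R'R mulNmx -(mulmxA _ P') P'P mulmx1 addNr.
by rewrite -scalar_mx_block.
Qed.

Lemma mutual_inverse_mx1 (D : unitRingType) (n : nat) :
  mutual_inverse_mx (1%:M : 'M[D]_n) 1%:M.
Proof. by split; rewrite mulmx1. Qed.

Lemma similar_mutual (D : unitRingType) (n : nat) (A P Q : 'M[D]_n) :
  mutual_inverse_mx P Q -> similar_mx A (P *m A *m Q).
Proof.
move=> [PQ QP]; exists Q, P; split=> //.
by rewrite !mulmxA QP mul1mx -mulmxA QP mulmx1.
Qed.

Lemma similar_mx_trans (D : unitRingType) (n : nat) (A B C : 'M[D]_n) :
  similar_mx A B -> similar_mx B C -> similar_mx A C.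
Proof.
move=> [P [P' [invP ->]]] [R [R' [invR ->]]]; exists (P *m R), (R' *m P').
by split; [exact: mutual_inverse_mxM | rewrite !mulmxA].
Qed.

Lemma diagonalizable_similar (D : unitRingType) (n : nat) (A B : 'M[D]_n) :
  similar_mx A B -> diagonalizable_mx B -> diagonalizable_mx A.
Proof. by move=> AB [d Bd]; exists d; apply: similar_mx_trans AB Bd. Qed.

Lemma diagonalizable_block (D : unitRingType) (p q : nat)
    (A : 'M[D]_p) (B : 'M[D]_q) :
  diagonalizable_mx A -> diagonalizable_mx B ->
  diagonalizable_mx (block_mx A 0 0 B).
Proof.
move=> [a [P [P' [invP ->]]]] [b [R [R' [invR ->]]]].
exists (row_mx a b), (block_mx P 0 0 R), (block_mx P' 0 0 R'); split.
  have := mutual_inverse_lblock 0 invP invR.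
  by rewrite mulmx0 mul0mx oppr0.
rewrite diag_mx_row !mulmx_block.
by rewrite !(mulmx0, mul0mx, addr0, add0r).
Qed.

Lemma diagonalizable_mx_diag (D : unitRingType) (n : nat) (d : 'rV[D]_n) :
  diagonalizable_mx (diag_mx d).
Proof.
exists d, 1%:M, 1%:M; split; first exact: mutual_inverse_mx1.
by rewrite mul1mx mulmx1.
Qed.

(** After a swap of columns the first entry of the row is a unit, and the row can then replace the
    first row of the identity: the result is block upper triangular with invertible diagonal
    blocks. *)
Lemma complete_row (D : unitRingType) (n : nat) (r : 'rV[D]_n) :
  division_ring D -> r != 0 ->
  exists m, (1 + m = n)%N /\ exists (P : 'M[D]_(1 + m, n)) (Q : 'M[D]_(n, 1 + m)),
    mutual_inverse_mx P Q /\ usubmx P = r.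
Proof.
move=> divD /rV0Pn[j rj0].
have [n' En] : exists n', (1 + n' = n)%N.
  by exists n.-1; rewrite add1n prednK // (leq_ltn_trans _ (ltn_ord j)).
subst n; exists n'; split=> //.
pose t := tperm_mx ord0 j : 'M[D]_(1 + n').
have tt : t *m t = 1%:M by rewrite -perm_mxM tperm2 perm_mx1.
pose r' := r *m t.
have r'0 : r' 0 0 = r 0 j.
  by rewrite /r' -xcolE !mxE tpermL.
pose x := lsubmx r'.
have xE : x = (r 0 j)%:M.
  by rewrite [x]mx11_scalar -r'0 {1}/x mxE; congr (r' _ _)%:M; apply/val_inj.
have ux := divD _ rj0.
pose x' := (r 0 j)^-1%:M : 'M[D]_1.
have xx' : mutual_inverse_mx x x'.
  by rewrite xE; split; rewrite -scalar_mxM ?mulrV ?mulVr.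
pose P := block_mx x (rsubmx r') 0 1%:M.
pose Q := block_mx x' (- (x' *m rsubmx r')) 0 1%:M.
exists (P *m t), (t *m Q); split; last first.
  by rewrite -mul_usub_mx /P block_mxEv col_mxKu hsubmxK -mulmxA tt mulmx1.
apply: mutual_inverse_mxM => //.
case: xx' => xx' x'x; split; rewrite mulmx_block.
  rewrite !mulmx0 !mul0mx !addr0 xx' mulmxN mulmxA xx' !mul1mx !mulmx1 addNr add0r.
  by rewrite -scalar_mx_block.
rewrite !mulmx0 !mul0mx !addr0 x'x !mulmx1 subrr add0r.
by rewrite -scalar_mx_block.
Qed.

(** Complete the first row to a basis [S]. In its coordinates the other rows split as [x] and [K'],
    where [K'] is free with one row fewer; after completing [K'], a lower block triangular factor
    puts [x] back. *)
Lemma complete_free_rows (D : unitRingType) (k n : nat) (K : 'M[D]_(k, n)) :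
  division_ring D -> free_rows K ->
  exists m, (k + m = n)%N /\ exists (P : 'M[D]_(k + m, n)) (Q : 'M[D]_(n, k + m)),
    mutual_inverse_mx P Q /\ forall i j, P (lshift m i) j = K i j.
Proof.
move=> divD; elim: k n K => [|k IHk] n K freeK.
  exists n; split=> //; exists 1%:M, 1%:M; split; first exact: mutual_inverse_mx1.
  by case.
move: K freeK; rewrite -[k.+1]/(1 + k)%N => K freeK.
have [r0|r0] := eqVneq (usubmx K) 0.
  (* If the first row were zero, (1, 0) would be a nontrivial relation between the rows. *)
  have := freeK (row_mx 1%:M 0 : 'rV_(1 + k)); rewrite -[K]vsubmxK mul_row_col r0 mulmx0 mul0mx.
  rewrite addr0 => /(_ erefl)/(congr1 lsubmx); rewrite row_mxKl raddf0.
  by move=> /matrixP/(_ 0 0)/eqP; rewrite !mxE eqxx mulr1n (negPf (oner_neq0 _)).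
have [n' [En [S [S' [invS Sr]]]]] := complete_row divD r0; subst n.
pose x := lsubmx (dsubmx K *m S'); pose K' := rsubmx (dsubmx K *m S').
have defK : K = block_mx 1%:M 0 x K' *m S.
  rewrite -[LHS]vsubmxK block_mxEv mul_col_mx hsubmxK -mulmxA invS.2 mulmx1.
  by rewrite -Sr -[S in RHS]vsubmxK mul_row_col mul1mx mul0mx addr0 Sr.
have freeK' : free_rows K'.
  move=> u uK'; have := freeK (row_mx (- (u *m x)) u).
  rewrite defK mulmxA mul_row_block mulmx1 addNr mulmx0 add0r uK' row_mx0 mul0mx.
  by move/(_ erefl)/(congr1 rsubmx); rewrite row_mxKr raddf0.
have [m [En' [P [Q [invP topP]]]]] := IHk _ _ freeK'; subst n'.
exists m; split=> //.
have invB := mutual_inverse_lblock (col_mx x 0) (mutual_inverse_mx1 D 1) invP.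
have invBS := mutual_inverse_mxM invB invS.
exists (block_mx 1%:M 0 (col_mx x 0) P *m S : 'M_(1 + (k + m), _)).
eexists; split; first exact: invBS.
move=> i j; rewrite defK !mxE; apply: eq_bigr => l _; congr (_ * _).
case: (split_ordP (i : 'I_(1 + k))) => i' ->.
  rewrite (_ : lshift m _ = (lshift (k + m) i' : 'I_(1 + k + m))); last exact/val_inj.
  by rewrite !block_mxEh; case: (split_ordP l) => l' ->; rewrite ?row_mxEl ?row_mxEr !col_mxEu.
rewrite (_ : lshift m _ = (rshift 1 (lshift m i') : 'I_(1 + k + m))); last exact/val_inj.
by case: (split_ordP l) => l' ->; rewrite ?block_mxEdl ?block_mxEdr ?col_mxEu ?topP.
Qed.

(** * Decomposition into companion matrices *)

(** In a relation [u], let [i] be the last index with a nonzero coefficient. In column [f i] the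
    earlier terms vanish by assumption and the later ones by the choice of [i], so the pivot kills
    the coefficient. *)
Lemma free_rows_pivot (D : unitRingType) (k n : nat) (K : 'M[D]_(k, n))
    (f : 'I_k -> 'I_n) :
  division_ring D -> (forall i, K i (f i) != 0) ->
  (forall i i' : 'I_k, (i' < i)%N -> K i' (f i) = 0) -> free_rows K.
Proof.
move=> divD piv0 below0 u uK0; apply/eqP; apply: contraT => /rV0Pn[i0 ui0].
pose i := [arg max_(i > i0 | u 0 i != 0) (i : nat)].
have [ui0' imax] : u 0 i != 0 /\ forall l, u 0 l != 0 -> (l <= i)%N.
  by rewrite /i; case: arg_maxnP.
have := congr1 (fun w : 'rV_n => w 0 (f i)) uK0.
rewrite !mxE (bigD1 i) //= big1 ?addr0 => [uK|l li]; last first.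
  case: (ltngtP l i) => [lti|gti|/val_inj eli]; last by rewrite eli eqxx in li.
    by rewrite below0 // mulr0.
  by case: (eqVneq (u 0 l) 0) => [->|/imax]; rewrite ?mul0r // leqNgt gti.
move: ui0'; rewrite -[u 0 i](mulrK (divD _ (piv0 i))) uK mul0r.
by rewrite eqxx.
Qed.

(** Matrices act on row vectors: each basis vector goes to the next one, and the last row is
    arbitrary. *)
Definition companion (D : unitRingType) (k : nat) (C : 'M[D]_k.+1) : Prop :=
  forall i j : 'I_k.+1, (i < k)%N -> C i j = (j == i.+1 :> nat)%:R.

Lemma mul_companion (D : unitRingType) (p k : nat) (C : 'M[D]_k.+1)
    (a : 'M[D]_(p, k.+1)) i (j l : 'I_k.+1) :
  companion C -> (j = l.+1 :> nat)%N ->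
  (a *m C) i j = a i l + a i ord_max * C ord_max j.
Proof.
move=> compC jl; rewrite mxE big_ord_recr /=; congr (_ + _).
have ltlk : (l < k)%N by rewrite -ltnS -jl.
rewrite (bigD1 (Ordinal ltlk)) //= big1 ?addr0 => [|q ql].
  by rewrite compC //= jl eqxx mulr1; congr (a _ _); apply/val_inj.
rewrite compC //= jl eqSS (_ : (_ == _) = false) ?mulr0 //.
by apply: contraNF ql => /eqP e; apply/eqP/val_inj.
Qed.

Definition krylov (D : unitRingType) (n : nat) (A : 'M[D]_n) (v : 'rV[D]_n)
    (i : nat) : 'rV[D]_n := iter i (mulmx^~ A) v.

(** Conjugation by the unipotent matrix with corner [Y] turns [X] into [X + Y C - A Y]. Right
    multiplication by [C] shifts columns to the right, so all columns but the first are cleared by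
    solving for the columns of [Y] backwards from the last. *)
Lemma normalize_corner (D : unitRingType) (k m : nat) (C : 'M[D]_k.+1)
    (X : 'M[D]_(m, k.+1)) (A : 'M[D]_m) :
  companion C ->
  exists X', similar_mx (block_mx C 0 X A) (block_mx C 0 X' A) /\
    forall i (j : 'I_k.+1), j != 0 -> X' i j = 0.
Proof.
move=> compC.
(* [y t] is column [k - t] of [Y]; its start value 0 removes the contribution of the last row of
   [C]. *)
pose y t : 'cV_m := iteri t (fun s z => A *m z - col (inord (k - s)) X) 0.
pose Y : 'M_(m, k.+1) := \matrix_(i, l) y (k - l)%N i 0.
have invU := mutual_inverse_lblock Y (mutual_inverse_mx1 D k.+1)
                                     (mutual_inverse_mx1 D m).
exists (X + Y *m C - A *m Y); split.
  have := similar_mutual (block_mx C 0 X A) invU.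
  rewrite !mulmx_block !(mul1mx, mulmx1, mul0mx, mulmx0, addr0, add0r).
  by rewrite mulmxN (addrC X).
move=> i j j0; have ltj : (j.-1 < k.+1)%N by have := ltn_ord j; lia.
have jl : (j = (Ordinal ltj).+1 :> nat)%N by rewrite /= prednK // lt0n.
have YA : (A *m Y) i j = (A *m y (k - j)%N) i 0.
  by rewrite !mxE; apply: eq_bigr => q _; rewrite mxE.
rewrite mxE [X in X + _]mxE [X in _ + X]mxE YA (mul_companion _ _ compC jl).
rewrite !mxE /= subnn /= mxE mul0r addr0.
have -> : (k - j.-1 = (k - j).+1)%N by move: j0 (ltn_ord j); rewrite -val_eqE /=; lia.
rewrite /= -/(y (k - j)%N) !mxE.
have -> : inord (k - (k - j)) = j.
  by apply/val_inj; rewrite /= inordK; have := ltn_ord j; lia.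
by rewrite addrCA subrr addr0 subrr.
Qed.

(** Each Krylov vector but the last is sent to the next one, which is again a vector of the new
    basis. *)
Lemma krylov_basis (D : unitRingType) (k m : nat) (A : 'M[D]_(k.+1 + m)) v P Q :
  mutual_inverse_mx P Q ->
  (forall (i : 'I_k.+1) j, P (lshift m i) j = krylov A v i 0 j) ->
  forall (i : 'I_k.+1) j, (i < k)%N ->
  (P *m A *m Q) (lshift m i) j = (j == i.+1 :> nat)%:R.
Proof.
move=> [PQ _] topP i j ik.
have rowP (l : 'I_k.+1) : row (lshift m l) P = krylov A v l.
  by apply/rowP=> c; rewrite mxE topP.
have lti : (i.+1 < k.+1)%N by exact: ik.
have -> : (P *m A *m Q) (lshift m i) j = row (lshift m i) (P *m A *m Q) 0 j.
  by rewrite [RHS]mxE.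
rewrite !row_mul rowP -[_ *m A]/(krylov A v (Ordinal lti)) -(rowP (Ordinal lti)) -row_mul PQ.
by rewrite !mxE -val_eqE /= eq_sym.
Qed.

(* The bottom row of the upper blocks leaves the span of the first k.+1 basis
   vectors, so the Krylov sequence of the first one is longer. *)
Lemma krylov_extend_right (D : unitRingType) (k m : nat) (C : 'M[D]_k.+1)
    d X (A : 'M[D]_m) :
  division_ring D ->
  (forall (i : 'I_k.+1) j, (i < k)%N ->
     block_mx C d X A (lshift m i) j = (j == i.+1 :> nat)%:R) ->
  d != 0 ->
  free_rows (\matrix_(i < k.+2) krylov (block_mx C d X A) (delta_mx 0 0) i).
Proof.
set B := block_mx C d X A => divD shiftB d0.
(* By [shiftB] the other rows of [d] are zero. *)
have [j0 dj0] : exists j0, d ord_max j0 != 0.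
  have [i [j dij]] := matrix0Pn _ d0; exists j.
  have [ik|ki] := ltnP i k; last first.
    rewrite (_ : ord_max = i) //; apply/val_inj => /=.
    by apply/eqP; rewrite eqn_leq ki -ltnS ltn_ord.
  move: dij; rewrite -(block_mxEur C d X A i j) shiftB //= eqn_leq leqNgt.
  by rewrite ltnS (leq_trans ik) ?leq_addr // eqxx.
have krE i (o : 'I_(k.+1 + m)) :
    (o = i :> nat)%N -> (i <= k)%N -> krylov B (delta_mx 0 0) i = delta_mx 0 o.
  elim: i o => [|i IHi] o oi ik.
    by rewrite /krylov /=; congr (delta_mx _ _); apply/val_inj; rewrite /= oi.
  have lti : (i < k.+1)%N by exact: ltnW.
  rewrite /krylov iterS -/(krylov _ _ _) (IHi (lshift m (Ordinal lti))) // ?ltnW //.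
  rewrite -rowE; apply/rowP=> j; rewrite mxE shiftB // mxE /= -oi.
  by rewrite -val_eqE.
(* The first [k.+1] Krylov vectors are unit vectors; the next is the last upper row of [B], with its
   pivot in [d]. *)
pose f (i : 'I_k.+2) : 'I_(k.+1 + m) :=
  if (i <= k)%N then lshift m (inord i) else rshift k.+1 j0.
have krE' (i : 'I_k.+2) : (i <= k)%N -> krylov B (delta_mx 0 0) i = delta_mx 0 (f i).
  by move=> ik; apply: krE; rewrite // /f ik /= inordK.
apply: (free_rows_pivot (f := f)) => // [i|i i' ii']; rewrite mxE.
  have [ik|ki] := leqP i k; first by rewrite krE' // mxE !eqxx oner_neq0.
  have -> : i = k.+1 :> nat by apply/eqP; rewrite eqn_leq ki -ltnS ltn_ord.
  rewrite /krylov iterS -/(krylov _ _ _) (krE _ (lshift m ord_max)) //.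
  by rewrite -rowE mxE /f leqNgt ki block_mxEur.
rewrite krE'; last by rewrite -ltnS (leq_trans ii') // -ltnS.
have i'k : (i' <= k)%N by rewrite -ltnS (leq_trans ii') // -ltnS.
rewrite mxE eqxx /= (_ : (_ == _) = false) //; apply/negP=> /eqP/(congr1 val).
rewrite /f i'k; case: leqP => ik /=; rewrite !inordK //; lia.
Qed.

(** The start vector lies outside the companion block. The first step puts [X i0 0] in coordinate 0,
    and each further step moves this leading entry one place to the right; the [k.+1] coordinates of
    the block and the start vector give [k.+2] pivots. *)
Lemma krylov_extend_below (D : unitRingType) (k m : nat) (C : 'M[D]_k.+1)
    (X : 'M[D]_(m, k.+1)) (A : 'M[D]_m) (i0 : 'I_m) :
  division_ring D -> companion C ->
  (forall i (j : 'I_k.+1), j != 0 -> X i j = 0) -> X i0 0 != 0 ->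
  free_rows (\matrix_(i < k.+2)
    krylov (block_mx C 0 X A) (delta_mx 0 (rshift k.+1 i0)) i).
Proof.
set B := block_mx C 0 X A; set v := delta_mx _ _ => divD compC Xcol Xi0.
pose a i := lsubmx (krylov B v i).
have a0 : a 0%N = 0.
  by apply/rowP=> j; rewrite /a !mxE eq_lrshift andbF.
have aS i : a i.+1 = a i *m C + rsubmx (krylov B v i) *m X.
  rewrite /a /krylov iterS -/(krylov B v i) -[in LHS](hsubmxK (krylov B v i)).
  by rewrite mul_row_block row_mxKl.
have aE i : (i <= k.+1)%N -> (forall l : 'I_k.+1, (i <= l)%N -> a i 0 l = 0) /\
    forall l : 'I_k.+1, (i = l.+1)%N -> a i 0 l = X i0 0.
  elim: i => [_|i IHi ik]; first by split=> // l _; rewrite a0 mxE.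
  have [aup alow] := IHi (ltnW ik).
  have aSE (l' l : 'I_k.+1) : (l' = l.+1 :> nat)%N -> a i.+1 0 l' = a i 0 l.
    (* As [i <= k], the last coordinate of [a i] is still zero, so the arbitrary last row of [C]
       does not enter. *)
    move=> ll; rewrite aS mxE (mul_companion _ _ compC ll).
    rewrite (aup ord_max) // mul0r addr0 [X in _ + X]mxE big1 ?addr0 // => q _.
    by rewrite Xcol ?mulr0 // -val_eqE /= ll.
  have a1 : i = 0%N -> a i.+1 0 0 = X i0 0.
    move=> i0E; rewrite aS mxE i0E a0 mul0mx mxE add0r mxE.
    rewrite (bigD1 i0) //= big1 => [|q qi].
      by rewrite !mxE !eqxx mul1r addr0.
    by rewrite !mxE eqxx (inj_eq (@rshift_inj _ _)) (negPf qi) mul0r.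
  split=> [l il|l].
    have ltl : (l.-1 < k.+1)%N by have := ltn_ord l; lia.
    by rewrite (aSE l (Ordinal ltl)) ?aup //=; lia.
  case: (posnP l) => [l0 [i0E]|lpos [il]].
    by rewrite (_ : l = 0) ?a1 ?i0E //; apply/val_inj.
  have ltl : (l.-1 < k.+1)%N by have := ltn_ord l; lia.
  by rewrite (aSE l (Ordinal ltl)) ?alow //=; lia.
pose f (i : 'I_k.+2) : 'I_(k.+1 + m) :=
  if i == 0 then rshift k.+1 i0 else lshift m (inord i.-1).
have krE i (l : 'I_k.+1) : krylov B v i 0 (lshift m l) = a i 0 l by rewrite mxE.
have le_i (i : 'I_k.+2) : (i <= k.+1)%N by rewrite -ltnS.
apply: (free_rows_pivot (f := f)) => // [i|i i' ii']; rewrite mxE /f.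
  case: (eqVneq i 0) => [->|i_n0]; first by rewrite mxE !eqxx oner_neq0.
  rewrite krE (aE _ (le_i i)).2 // inordK; have := le_i i; move: i_n0; rewrite -val_eqE /=; lia.
rewrite (_ : (i == 0) = false); last by rewrite -val_eqE /=; lia.
rewrite krE (aE _ (le_i i')).1 // inordK; have := le_i i; lia.
Qed.

(* A cyclic subspace of maximal dimension has an invariant complement: once the
   corner below the companion block is reduced to its first column, a nonzero
   entry there would start a longer Krylov sequence. *)
Lemma companion_ind (D : unitRingType) (G : forall n, 'M[D]_n -> Prop) :
  division_ring D ->
  (forall n (A B : 'M_n), similar_mx A B -> G n B -> G n A) ->
  (forall A : 'M_0, G 0 A) ->
  (forall k m (C : 'M_k.+1) (A : 'M_m),
     companion C -> G m A -> G (k.+1 + m)%N (block_mx C 0 0 A)) ->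
  forall n (A : 'M_n), G n A.
Proof.
move=> divD Gsim G0 Gblock n; elim/ltn_ind: n => n IHn A.
have [n0|n_gt0] := posnP n; first by subst n; exact: G0.
(* Induction on the room left for a longer Krylov sequence; [B] and [v] vary, since each round
   passes to a similar matrix and may restart from another vector. *)
have main j k (B : 'M_n) v : (n - k <= j)%N ->
    free_rows (\matrix_(i < k.+1) krylov B v i) -> G n B.
  elim: j k B v => [|j IHj] k B v jk freeK.
    (* Here [n <= k], which leaves no place for [k.+1] free rows. *)
    by have [m [Em _]] := complete_free_rows divD freeK; lia.
  have [m [Em [P [Q [invP topP]]]]] := complete_free_rows divD freeK; subst n.
  apply: (Gsim _ _ _ (similar_mutual B invP)).
  have := krylov_basis invP (fun i j => etrans (topP i j) (mxE _ _ _ _)).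
  move: (P *m B *m Q) => {topP invP P Q freeK}B.
  rewrite -[B]submxK; set C := ulsubmx B; set d := ursubmx B => shiftB.
  have [d0|d_n0] := eqVneq d 0; last first.
    by apply: (IHj _ _ _ _ (krylov_extend_right divD shiftB d_n0)); lia.
  have compC : companion C.
    by move=> i l ik; have := shiftB i (lshift m l) ik; rewrite block_mxEul.
  rewrite d0; have [X [simX Xcol]] := normalize_corner (dlsubmx B) (drsubmx B) compC.
  apply: (Gsim _ _ _ simX).
  have [->|/matrix0Pn[i0 [l Xil]]] := eqVneq X 0.
    by apply: Gblock => //; apply: IHn; lia.
  have Xi0 : X i0 0 != 0 by case: (eqVneq l 0) Xil => [->|/Xcol->]; rewrite ?eqxx.
  have := krylov_extend_below (A := drsubmx B) divD compC Xcol Xi0.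
  by apply: IHj; lia.
pose o := Ordinal n_gt0.
apply: (main n 0%N A (delta_mx 0 o)); first by lia.
apply: (free_rows_pivot (f := fun=> o)) => // [i|]; last by case=> [[]] // ? [[]].
by rewrite ord1 !mxE !eqxx oner_neq0.
Qed.

(** * Diagonalizability of perturbed involutions *)

(** The line of [g] and the rows killing [e] are invariant and complementary because [g e] is
    nonzero. Over a noncommutative [D], rows are scaled on the left and columns on the right. The
    form of [P *m e] serves to follow a perturbation [e y] to the complement. *)
Lemma split_eigenvector (D : unitRingType) (n : nat) (M : 'M[D]_n)
    (g : 'rV[D]_n) (e : 'cV[D]_n) (u w c : D) :
  division_ring D -> c != 0 -> g *m M = u *: g -> M *m e = e *m w%:M ->
  g *m e = c%:M ->
  exists m, (1 + m = n)%N /\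
  exists (P : 'M[D]_(1 + m, n)) (Q : 'M[D]_(n, 1 + m)),
    mutual_inverse_mx P Q /\ exists (M' : 'M[D]_m) (c' : 'M[D]_1),
      P *m M *m Q = block_mx u%:M 0 0 M' /\ P *m e = col_mx c' 0.
Proof.
move=> divD c0 gM Me ge; have uc := divD _ c0.
have g0 : g != 0.
  apply: contraNneq c0 => g0; move: ge; rewrite g0 mul0mx.
  by move/matrixP/(_ 0 0)/eqP; rewrite !mxE eqxx mulr1n eq_sym.
have [m [En [P [Q [invP topP]]]]] := complete_row divD g0; subst n.
pose e' := e *m c^-1%:M.
have eE : e = e' *m c%:M by rewrite -mulmxA -scalar_mxM mulVr // mulmx1.
have ge' : g *m e' = 1%:M by rewrite mulmxA ge -scalar_mxM mulrV.
(* Both sides are [g M e]; thus [u] and [w] are conjugate, and rescaling [e] makes them equal. *)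
have cw : u * c = c * w.
  have /matrixP/(_ 0 0) : g *m M *m e = c%:M *m w%:M by rewrite -mulmxA Me mulmxA ge.
  by rewrite gM -scalemxAl ge -scalar_mxM !mxE eqxx !mulr1n.
have Me' : M *m e' = e' *m u%:M.
  rewrite mulmxA Me -!mulmxA -!scalar_mxM; congr (_ *m _%:M).
  by rewrite -[u](mulrK uc) cw !mulrA mulVr // mul1r.
(* Subtracting multiples of [g] from the other basis rows makes them kill [e']. *)
pose p := dsubmx (P *m e').
have Pe' : P *m e' = col_mx 1%:M p.
  by rewrite -[LHS]vsubmxK; congr col_mx; rewrite -mul_usub_mx topP.
have := mutual_inverse_lblock (- p) (mutual_inverse_mx1 D 1) (mutual_inverse_mx1 D m).
rewrite mul1mx mulmx1 opprK; set L := block_mx _ _ _ _; set L' := block_mx _ _ _ _.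
move=> /mutual_inverse_mxM/(_ invP); set P1 := L *m P; set Q1 := Q *m L' => invP1.
exists m; split=> //; exists P1, Q1; split=> //.
have P1e' : P1 *m e' = col_mx 1%:M 0.
  rewrite -mulmxA Pe' mul_block_col !mul1mx mul0mx addr0 mulmx1 addNr //.
have topP1 : usubmx P1 = g.
  by rewrite -mul_usub_mx /L block_mxEv col_mxKu -[P]vsubmxK topP mul_row_col
             mul1mx mul0mx addr0.
have [P1Q1 Q1P1] := invP1; clearbody P1 Q1 e'.
pose N := P1 *m M *m Q1.
have upN : usubmx N = row_mx u%:M 0.
  rewrite -2!mul_usub_mx topP1 gM -scalemxAl -topP1 mul_usub_mx P1Q1.
  rewrite [1%:M](@scalar_mx_block _ 1 m) block_mxEv col_mxKu.
  by rewrite scale_row_mx scaler0 scalemx1.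
have leftN : lsubmx N = col_mx u%:M 0.
  have : N *m (P1 *m e') = col_mx u%:M 0.
    rewrite /N -!mulmxA (mulmxA Q1) Q1P1 mul1mx Me' mulmxA P1e' mul_col_mx.
    by rewrite mul1mx mul0mx.
  by rewrite P1e' -[in LHS](hsubmxK N) mul_row_col mulmx1 mulmx0 addr0.
exists (drsubmx N), c%:M; split; last first.
  by rewrite eE mulmxA P1e' mul_col_mx mul1mx mul0mx.
have dl (X : 'M[D]_(1 + m)) : lsubmx (dsubmx X) = dsubmx (lsubmx X).
  by apply/matrixP=> i j; rewrite !mxE.
rewrite -/N -[LHS]submxK /ulsubmx /ursubmx /dlsubmx upN row_mxKl row_mxKr.
by rewrite dl leftN col_mxKd.
Qed.

Lemma diagonalizable_scalar_mx (D : unitRingType) (n : nat) (a : D) :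
  diagonalizable_mx (a%:M : 'M[D]_n).
Proof. by rewrite -diag_const_mx; exact: diagonalizable_mx_diag. Qed.

Lemma diagonalizable_split (D : unitRingType) (m : nat) (M P Q : 'M[D]_(1 + m))
    (u : D) (M' : 'M[D]_m) :
  mutual_inverse_mx P Q -> P *m M *m Q = block_mx u%:M 0 0 M' ->
  diagonalizable_mx M' -> diagonalizable_mx M.
Proof.
move=> invP PMQ diagM'; apply: diagonalizable_similar (similar_mutual M invP) _.
by rewrite PMQ; apply: diagonalizable_block; first exact: diagonalizable_scalar_mx.
Qed.

(** The rows and columns of [M - 1] are eigenvectors for -1, and [(M - 1)^2 = -2 (M - 1)]. A nonzero
    entry [c] thus gives a row and a column with product [-2 c], and -1 splits off. *)
Lemma diagonalizable_involution (D : unitRingType) (n : nat) (M : 'M[D]_n) :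
  division_ring D -> 2%:R != 0 :> D -> M *m M = 1%:M -> diagonalizable_mx M.
Proof.
move=> divD two0; elim/ltn_ind: n => n IHn in M *; move=> MM.
have [M1|/matrix0Pn[i [j Mij]]] := eqVneq (M - 1%:M) 0.
  by rewrite (subr0_eq M1); exact: diagonalizable_scalar_mx.
set c := _ i j in Mij.
have c0 : - (c *+ 2) != 0.
  rewrite oppr_eq0 -mulr_natr; apply: contraNneq Mij => c2.
  by rewrite -[c](mulrK (divD _ two0)) c2 mul0r.
have mul_col p (X : 'M_(p, n)) Y : X *m col j Y = col j (X *m Y).
  by rewrite !colE mulmxA.
have gM : row i (M - 1%:M) *m M = (-1) *: row i (M - 1%:M).
  by rewrite -row_mul mulmxBl MM mul1mx scaleN1r -opprB linearN.
have Me : M *m col j (M - 1%:M) = col j (M - 1%:M) *m (-1)%:M.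
  rewrite mul_col mulmxBr MM mulmx1 (raddfN (@scalar_mx D 1)) mulmxN mulmx1.
  by rewrite -opprB linearN.
have ge : row i (M - 1%:M) *m col j (M - 1%:M) = (- (c *+ 2))%:M.
  rewrite mul_col -row_mul [LHS]mx11_scalar; congr _%:M; rewrite 2!mxE.
  have -> : (M - 1%:M) *m (M - 1%:M) = - ((M - 1%:M) *+ 2).
    rewrite mulmxBl mulmxBr MM mulmx1 mul1mx mulr2n [RHS]opprD.
    by rewrite -[1%:M - M]opprB.
  by rewrite /c mxE mulmxnE.
have [m [En [P [Q [invP [M' [c' [PMQ _]]]]]]]] :=
  split_eigenvector divD c0 gM Me ge; subst n.
apply: (diagonalizable_split invP PMQ); apply: IHn; first lia.
have: (P *m M *m Q) *m (P *m M *m Q) = 1%:M.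
  rewrite !mulmxA -(mulmxA _ Q) invP.2 mulmx1 -(mulmxA _ M M) MM mulmx1.
  exact: invP.1.
rewrite PMQ mulmx_block !mulmx0 !mul0mx !addr0 add0r scalar_mx_block.
by case/eq_block_mx.
Qed.

(* From [M^2 - 1 = e y] and [M e = e w] one gets [y e = w^2 - 1] and [y M = w y],
   so [y] and [e] split off the eigenvalue [w], leaving an involution. *)
Lemma diagonalizable_rank_one (D : unitRingType) (n : nat) (M : 'M[D]_n)
    (e : 'cV[D]_n) (y : 'rV[D]_n) (w : D) :
  division_ring D -> 2%:R != 0 :> D -> e != 0 -> w * w != 1 ->
  M *m M = 1%:M + e *m y -> M *m e = e *m w%:M -> diagonalizable_mx M.
Proof.
move=> divD two0 /cV0Pn[i ei0] w2 MM Me.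
have cancel_e p (X Y : 'M[D]_(1, p)) : e *m X = e *m Y -> X = Y.
  move=> eXY; apply/rowP=> j; apply: (mulrI (divD _ ei0)).
  by have := congr1 (fun Z : 'M_(n, p) => Z i j) eXY; rewrite !mxE !big_ord1.
have ey : e *m y = M *m M - 1%:M by rewrite MM addrC addKr.
have c0 : w * w - 1 != 0 by rewrite subr_eq0.
have ye : y *m e = (w * w - 1)%:M.
  apply: cancel_e; rewrite mulmxA ey mulmxBl mul1mx -mulmxA Me mulmxA Me.
  by rewrite -mulmxA -scalar_mxM raddfB /= mulmxBr mulmx1.
have yM : y *m M = w *: y.
  apply: cancel_e; rewrite -mul_scalar_mx !mulmxA -Me ey mulmxBl mul1mx.
  by rewrite -[M *m e *m y]mulmxA ey mulmxBr mulmx1 mulmxA.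
have [m [En [P [Q [invP [M' [c' [PMQ Pe]]]]]]]] :=
  split_eigenvector divD c0 yM Me ye; subst n.
apply: (diagonalizable_split invP PMQ); apply: diagonalizable_involution => //.
(* Only the first coordinate of [P *m e] can be nonzero, so the perturbation misses the block
   [M']. *)
have: (P *m M *m Q) *m (P *m M *m Q) = 1%:M + (P *m e) *m (y *m Q).
  rewrite !mulmxA -(mulmxA _ Q) invP.2 mulmx1 -(mulmxA _ M M) MM.
  by rewrite mulmxDr mulmx1 mulmxDl invP.1 !mulmxA.
rewrite PMQ mulmx_block !mulmx0 !mul0mx !addr0 add0r scalar_mx_block Pe.
rewrite -[y *m Q]hsubmxK mul_col_row !mul0mx add_block_mx !addr0.
by case/eq_block_mx.
Qed.

(** * Factoring a companion matrix *)

(** [w] commutes with 1, so [(w - 1) (w + 1) = w^2 - 1] in any ring. *)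
Lemma division_ring_sqr_eq1 (D : unitRingType) (w : D) :
  division_ring D -> w * w = 1 -> w = 1 \/ w = -1.
Proof.
move=> divD ww; have [->|w1] := eqVneq w 1; [by left | right].
have uw : w - 1 \is a GRing.unit by apply: divD; rewrite subr_eq0.
apply/eqP; rewrite -subr_eq0 opprK; apply/eqP/(mulrI uw).
by rewrite mulr0 mulrBl mul1r mulrDr mulr1 ww (addrC w) subrr.
Qed.

Definition flip_mx (D : unitRingType) (n : nat) : 'M[D]_n :=
  \matrix_(i, j) (j == rev_ord i)%:R.

Lemma row_flip (D : unitRingType) (n : nat) (i : 'I_n) :
  row i (flip_mx D n) = delta_mx 0 (rev_ord i).
Proof. by apply/rowP=> j; rewrite !mxE. Qed.

Lemma mul_flip_delta (D : unitRingType) (n : nat) (j : 'I_n) :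
  flip_mx D n *m delta_mx j 0 = delta_mx (rev_ord j) 0 :> 'cV_n.
Proof.
rewrite -colE; apply/colP=> i; rewrite !mxE andbT.
by rewrite -(inj_eq rev_ord_inj) rev_ordK eq_sym.
Qed.

Lemma mul_delta_flip (D : unitRingType) (n : nat) (i : 'I_n) :
  delta_mx 0 i *m flip_mx D n = delta_mx 0 (rev_ord i) :> 'rV_n.
Proof. by rewrite -rowE row_flip. Qed.

Lemma flip_mxK (D : unitRingType) (n : nat) :
  flip_mx D n *m flip_mx D n = 1%:M.
Proof.
apply/row_matrixP=> i.
by rewrite row_mul row_flip mul_delta_flip rev_ordK row1.
Qed.

Lemma mul_delta_mx00 (D : unitRingType) (n : nat) (i j : 'I_n) :
  delta_mx 0 i *m delta_mx j 0 = (i == j)%:R%:M :> 'M[D]_1.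
Proof.
case: eqVneq => [->|ij]; first by rewrite mul_delta_mx [LHS]mx11_scalar mxE.
by rewrite mul_delta_mx_0 // raddf0.
Qed.

Lemma rev_ord_max (n : nat) : rev_ord (@ord_max n) = ord0.
Proof. by apply/val_inj; rewrite /= subnn. Qed.

Lemma rev_ord0 (n : nat) : rev_ord (@ord0 n) = ord_max.
Proof. by apply/val_inj; rewrite /= subn1. Qed.

(** The matrix J: the correction replaces the last row [e_0] of the reversal by
    [(1 + a) e_last - a e_0]. *)
Definition skew_flip (D : unitRingType) (n : nat) (a : D) : 'M[D]_n.+1 :=
  flip_mx D n.+1 -
  (delta_mx ord_max 0 : 'cV_n.+1) *m ((1 + a) *: (delta_mx 0 0 - delta_mx 0 ord_max)).

(** Here the first row of the reversal is corrected, to [(1 + a^-1) e_0 - a^-1 e_last]. *)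
Definition skew_flip_inv (D : unitRingType) (n : nat) (a : D) : 'M[D]_n.+1 :=
  flip_mx D n.+1 +
  (delta_mx 0 0 : 'cV_n.+1) *m ((1 + a^-1) *: (delta_mx 0 0 - delta_mx 0 ord_max)).

Lemma skew_flip_invK (D : unitRingType) (n : nat) (a : D) :
  a \is a GRing.unit -> skew_flip_inv n.+1 a *m skew_flip n.+1 a = 1%:M.
Proof.
move=> ua; rewrite /skew_flip_inv /skew_flip.
set F := flip_mx _ _; set E0 := delta_mx 0 0 : 'cV_n.+2.
set E := delta_mx ord_max 0 : 'cV_n.+2; set d := _ - _ : 'rV_n.+2.
have FE : F *m E = E0 by rewrite mul_flip_delta rev_ord_max.
have dF : d *m F = - d.
  by rewrite mulmxBl !mul_delta_flip rev_ord_max rev_ord0 opprB.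
have dE : d *m E = (-1)%:M by rewrite mulmxBl !mul_delta_mx00 eqxx (_ : (0 == ord_max) = false) // raddf0 sub0r raddfN.
rewrite mulmxDl !mulmxBr flip_mxK mulmxA FE.
rewrite -[E0 *m _ *m F]mulmxA -[E0 *m _ *m (E *m _)]mulmxA (mulmxA _ E) -!scalemxAl dF dE.
rewrite mul_scalar_mx scaleN1r -addrA -[RHS]addr0; congr (_ + _).
rewrite !scalerN -!mulmxN -!mulmxDr opprK -!scaleNr scalerA -!scalerDl.
(* The rank-one terms cancel because [(1 + a^-1) (1 + a) = (1 + a^-1) + (1 + a)]. *)
rewrite mulrDl mul1r mulrDr mulr1 mulVr // (_ : _ + _ = 0) ?scale0r ?mulmx0 //.
by rewrite (addrC a^-1) [X in _ + X]addrCA addNr addr0 addNr.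
Qed.

Lemma skew_flip_diagonalizable (D : unitRingType) (n : nat) (a : D) :
  division_ring D -> 2%:R != 0 :> D -> (a != -1 -> a * a != 1) ->
  diagonalizable_mx (skew_flip n.+1 a).
Proof.
move=> divD two0 a2; have [->|a1] := eqVneq a (-1).
  rewrite /skew_flip subrr scale0r mulmx0 subr0.
  by apply: diagonalizable_involution => //; exact: flip_mxK.
rewrite /skew_flip.
set F := flip_mx _ _; pose E0 := delta_mx 0 0 : 'cV[D]_n.+2.
set E := delta_mx ord_max 0 : 'cV_n.+2; set d := _ - _ : 'rV_n.+2.
have FE : F *m E = E0 by rewrite mul_flip_delta rev_ord_max.
have FE0 : F *m E0 = E by rewrite mul_flip_delta rev_ord0.
have dF : d *m F = - d.
  by rewrite mulmxBl !mul_delta_flip rev_ord_max rev_ord0 opprB.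
have dE : d *m E = (-1)%:M.
  by rewrite mulmxBl !mul_delta_mx00 eqxx (_ : (0 == ord_max) = false) // raddf0 sub0r raddfN.
have dE0 : d *m E0 = 1%:M.
  by rewrite mulmxBl !mul_delta_mx00 eqxx (_ : (ord_max == 0) = false) // raddf0 subr0.
pose y := - (1 + a) *: d.
rewrite -mulmxN -scaleNr -/y.
have yF : y *m F = - y by rewrite -scalemxAl dF scalerN.
have yE : y *m E = (1 + a)%:M.
  by rewrite -scalemxAl dE scale_scalar_mx mulrN1 opprK.
have yE0 : y *m E0 = (- (1 + a))%:M by rewrite -scalemxAl dE0 scale_scalar_mx mulr1.
(* The square of [F + E y] is [1 + E0 y - E y + E (1 + a) y], whence the column [E0 + E a]. *)
apply: (@diagonalizable_rank_one _ _ _ (E0 + E *m a%:M) y a) => //.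
- apply/cV0Pn; exists 0.
  by rewrite !mxE big_ord1 !mxE /= mul0r addr0 oner_neq0.
- exact: a2.
- rewrite mulmxDr !mulmxDl flip_mxK (mulmxA F) FE -addrA; congr (_ + _).
  rewrite -[E *m y *m F]mulmxA yF -(mulmxA E y) (mulmxA y) yE.
  rewrite mulmxN addrCA; congr (_ + _).
  by rewrite raddfD /= mulmxDl mulmxDr mul1mx addKr mulmxA.
rewrite mulmxDr !mulmxDl FE0 -[E *m y *m E0]mulmxA yE0 (mulmxA F) FE.
rewrite -[E *m y *m _]mulmxA (mulmxA y) yE -[E *m a%:M *m _]mulmxA -!scalar_mxM.
rewrite addrCA addrAC -addrA; congr (_ + _).
rewrite -{1}[E]mulmx1 -!mulmxDr -!raddfD /=; congr (_ *m _%:M).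
by rewrite mulrDl mul1r !addrA addrAC subrr add0r.
Qed.

Lemma mul_companion_delta0 (D : unitRingType) (k : nat) (C : 'M[D]_k.+1) :
  companion C ->
  C *m delta_mx 0 0 = delta_mx ord_max 0 *m (C ord_max 0)%:M :> 'cV_k.+1.
Proof.
move=> compC; rewrite -colE; apply/colP=> i; rewrite !mxE big_ord1 !mxE.
rewrite eqxx mulr1n andbT.
case: (eqVneq i ord_max) => [->|i_max]; first by rewrite mul1r.
rewrite mul0r compC // ltn_neqAle -ltnS ltn_ord andbT.
by apply: contraNneq i_max => ik; apply/eqP/val_inj.
Qed.

(** [M^2 - 1] vanishes outside its last row, so it is [e_last y] with [y] that row. The column
    [e_last] has eigenvalue [w = - c a^-1], and [w = 1] or [w = -1] would mean [c = -a] or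
    [c = a]. *)
Lemma companion_div_skew_flip_diagonalizable (D : unitRingType) (k : nat)
    (C : 'M[D]_k.+2) (a : D) :
  division_ring D -> 2%:R != 0 :> D -> companion C -> a != 0 ->
  C ord_max 0 != a -> C ord_max 0 != - a ->
  diagonalizable_mx (C *m skew_flip_inv k.+1 a).
Proof.
move=> divD two0 compC a0 ca cNa; set M := C *m _.
have ua := divD _ a0.
pose w := - (C ord_max 0 * a^-1).
have rowM (i : 'I_k.+2) (ik : (i < k.+1)%N) :
    row i M = delta_mx 0 (rev_ord (Ordinal (ik : (i.+1 < k.+2)%N))).
  have rowC : row i C = delta_mx 0 (Ordinal (ik : (i.+1 < k.+2)%N)).
    by apply/rowP=> j; rewrite !mxE compC //= -val_eqE.
  rewrite row_mul rowC mulmxDr mul_delta_flip mulmxA.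
  by rewrite mul_delta_mx00 raddf0 mul0mx addr0.
have rowMM (i : 'I_k.+2) : (i < k.+1)%N -> row i (M *m M) = row i 1%:M.
  move=> ik; have ik' : (rev_ord (Ordinal (ik : (i.+1 < k.+2)%N)) < k.+1)%N.
    by rewrite /=; lia.
  rewrite row_mul (rowM _ ik) -rowE (rowM _ ik') row1; congr (delta_mx _ _); apply/val_inj => /=.
  lia.
apply: (@diagonalizable_rank_one _ _ _ (delta_mx ord_max 0)
          (row ord_max (M *m M - 1%:M)) w) => //.
- by apply/cV0Pn; exists ord_max; rewrite mxE !eqxx oner_neq0.
- apply/eqP=> /(division_ring_sqr_eq1 divD) wE.
  have cE : C ord_max 0 = - w * a by rewrite opprK -mulrA mulVr // mulr1.
  case: wE cE => ->; rewrite ?opprK ?mul1r ?mulN1r => /eqP.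
    by rewrite (negPf cNa).
  by rewrite (negPf ca).
- apply/row_matrixP=> i; rewrite [RHS]raddfD /= [X in _ + X]row_mul.
  have rowE1 : row i (delta_mx ord_max 0 : 'cV[D]_k.+2) = (i == ord_max)%:R%:M.
    by apply/rowP=> j; rewrite !ord1 !mxE andbT mulr1n.
  rewrite rowE1 mul_scalar_mx; case: eqVneq => [->|i_max].
    by rewrite scale1r raddfB /= addrC subrK.
  rewrite scale0r addr0 rowMM // ltn_neqAle -ltnS ltn_ord andbT.
  by apply: contraNneq i_max => ik; apply/eqP/val_inj.
rewrite -mulmxA mulmxDl mul_flip_delta rev_ord_max -mulmxA -scalemxAl.
rewrite mulmxBl !mul_delta_mx00 eqxx (_ : (0 == ord_max) = false) // raddf0 sub0r.
rewrite scalerN scale_scalar_mx mulr1 mulmxN -{1}[delta_mx 0 0]mulmx1 -mulmxBr -raddfB /=.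
rewrite opprD addrA subrr sub0r mulmxA mul_companion_delta0 // -mulmxA -scalar_mxM.
by rewrite mulrN.
Qed.

Lemma companion_product (D : unitRingType) (k : nat) (C : 'M[D]_k.+1) (b : D) :
  division_ring D -> 2%:R != 0 :> D -> b != 0 -> b != 1 -> b != -1 ->
  companion C ->
  exists B B' : 'M[D]_k.+1,
    [/\ diagonalizable_mx B, diagonalizable_mx B' & C = B *m B'].
Proof.
move=> divD two0 b0 b1 bN1; case: k C => [|k] C compC.
  exists C, 1%:M; split; [|exact: diagonalizable_scalar_mx|by rewrite mulmx1].
  by rewrite [C]mx11_scalar; exact: diagonalizable_scalar_mx.
pose c := C ord_max 0.
have oneN1 : 1 != -1 :> D by rewrite -subr_eq0 opprK.
have [a [a0 ca cNa a2]] :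
    exists a, [/\ a != 0, c != a, c != - a & a != -1 -> a * a != 1].
  have b2 : b * b != 1.
    by apply/eqP=> /(division_ring_sqr_eq1 divD)[] /eqP; apply/negP.
  have [c1|c1] := eqVneq c 1.
    by exists b; rewrite c1 -eqr_oppLR !(eq_sym _ b); split.
  have [cN1|cN1] := eqVneq c (-1).
    by exists b; rewrite cN1 eqr_opp !(eq_sym _ b); split.
  by exists (-1); rewrite opprK eqxx oppr_eq0 oner_neq0; split.
exists (C *m skew_flip_inv k.+1 a), (skew_flip k.+1 a); split.
- exact: companion_div_skew_flip_diagonalizable.
- exact: skew_flip_diagonalizable.
by rewrite -mulmxA skew_flip_invK ?mulmx1 //; exact: divD.
Qed.

(** * The exceptional field, sharpness and assembly *)

Lemma field_of_three_elements (D : unitRingType) :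
  2%:R != 0 :> D -> (forall b : D, [\/ b = 0, b = 1 | b = -1]) ->
  is_field_of_three_elements D.
Proof.
move=> two0 elts.
have three0 : 3%:R = 0 :> D.
  (* Among 0, 1 and -1, the element 2 can only be -1. *)
  have := elts 2%:R; rewrite -[3%N]/(2 + 1)%N natrD => -[||] e.
  - by rewrite e eqxx in two0.
  - have := oner_neq0 D; rewrite -(addrK 1 (1 : D)) -[1 + 1]/(2%:R) e subrr.
    by rewrite eqxx.
  - by rewrite e addNr.
have natr3 n : (n %% 3)%:R = n%:R :> D.
  by rewrite [in RHS](divn_eq n 3) natrD natrM three0 mulr0 add0r.
pose f (x : 'F_3) : D := (x : nat)%:R.
have natrN (y : 'F_3) : (3 - y)%:R = - (y : nat)%:R :> D.
  by rewrite natrB ?three0 ?sub0r // ltnW //; exact: ltn_ord.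
have fD : zmod_morphism f.
  move=> x y; rewrite /f /= natr3 natrD /= natr3; congr (_ + _).
  exact: natrN.
have fM : monoid_morphism f.
  by split=> // x y; rewrite /f /= natr3 natrM.
pose f1 := GRing.isZmodMorphism.Build 'F_3 D f fD.
pose f2 := GRing.isMonoidMorphism.Build 'F_3 D f fM.
pose F : {rmorphism 'F_3 -> D} := HB.pack f f1 f2.
exists F; pose g (x : D) : 'F_3 := if x == 0 then 0 else if x == 1 then 1 else -1.
have oneN1 : -1 == 1 :> D = false by rewrite eq_sym -subr_eq0 opprK; exact/negbTE.
exists g => [x|x].
  rewrite -[F x]/(f x) /g /f; case: x => [[|[|[|//]]] ltx] /=; apply/val_inj => /=.
  - by rewrite eqxx.
  - by rewrite oner_eq0 eqxx.
  - by rewrite (negPf two0) -[2%:R]/(1 + 1) -subr_eq0 addrK oner_eq0.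
have f_N1 : f (-1) = -1.
  by rewrite /f /=; rewrite natr3 -[(_ - _)%N]/2%N; apply/eqP; rewrite -subr_eq0 opprK natr1 three0.
rewrite -[F _]/(f _) /g; case: (elts x) => ->; rewrite ?eqxx //.
  by rewrite oner_eq0.
by rewrite oppr_eq0 oner_eq0 oneN1.
Qed.

(** The matrix is nonzero with square zero, whereas a diagonal matrix over a field with square zero
    is zero. *)
Lemma nilpotent_not_diagonalizable :
  ~ diagonalizable_mx (delta_mx 0 1 : 'M[rat]_2).
Proof.
move=> [d [P [Q [[PQ QP] Adiag]]]].
have diagE : diag_mx d = Q *m delta_mx 0 1 *m P.
  by rewrite Adiag !mulmxA QP mul1mx -mulmxA QP mulmx1.
have d0 : d = 0.
  have : diag_mx d *m diag_mx d = 0.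
    rewrite diagE !mulmxA -(mulmxA _ P) PQ mulmx1 -(mulmxA Q) mul_delta_mx_0 //.
    by rewrite mulmx0 mul0mx.
  rewrite mulmx_diag => /matrixP dd; apply/rowP=> i; have := dd i i.
  by rewrite !mxE eqxx mulr1n => /eqP; rewrite mulf_eq0 orbb => /eqP.
move: Adiag; rewrite d0 raddf0 mulmx0 mul0mx => /matrixP/(_ 0 1).
by rewrite !mxE.
Qed.

Theorem theorem3p1 :
  (forall (D : unitRingType) (n : nat),
      division_ring D -> 2%N \notin [pchar D] ->
      ~ is_field_of_three_elements D -> (0 < n)%N ->
      forall A : 'M[D]_n,
      exists B C : 'M[D]_n,
        [/\ diagonalizable_mx B, diagonalizable_mx C & A = B *m C]) /\
  (exists (D : unitRingType) (n : nat),
      [/\ division_ring D, 2%N \notin [pchar D],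
          ~ is_field_of_three_elements D, (0 < n)%N &
          exists A : 'M[D]_n, ~ diagonalizable_mx A]).
Proof.
split=> [D n divD two notF3 _|]; last first.
  exists rat, 2%N; split=> //; last by exists (delta_mx 0 1); exact: nilpotent_not_diagonalizable.
  (* A morphism from the field of three elements would send 3 = 0 to 3, which is nonzero in
     [rat]. *)
  case=> f _; have /eqP := rmorph_nat f 3.
  by rewrite (_ : 3%:R = 0) ?rmorph0 //; exact/val_inj.
have two0 : 2%:R != 0 :> D by move: two; rewrite inE.
have [b [b0 b1 bN1]] : exists b : D, [/\ b != 0, b != 1 & b != -1].
  (* By excluded middle, the absence of such a [b] leaves only 0, 1 and -1 in [D]. *)
  apply: NNPP => noB; apply: notF3; apply: field_of_three_elements => // b.
  have [->|b0] := eqVneq b 0; first by constructor 1.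
  have [->|b1] := eqVneq b 1; first by constructor 2.
  have [->|bN1] := eqVneq b (-1); first by constructor 3.
  by case: noB; exists b.
pose G m (A : 'M[D]_m) := exists B C : 'M[D]_m,
  [/\ diagonalizable_mx B, diagonalizable_mx C & A = B *m C].
apply: (@companion_ind D G divD) => [m A A'|A|k m C A compC].
(* Conjugating both factors by the same matrix conjugates their product. *)
- move=> [P [Q [[PQ QP] ->]]] [B [C [diagB diagC ->]]].
  exists (P *m B *m Q), (P *m C *m Q); split.
  + by apply: diagonalizable_similar diagB; exists P, Q.
  + by apply: diagonalizable_similar diagC; exists P, Q.
  by rewrite !mulmxA -(mulmxA _ Q P) QP mulmx1.
- exists 1%:M, 1%:M; split; try exact: diagonalizable_scalar_mx.
  by apply/matrixP; case.
move=> [B [B' [diagB diagB' ->]]].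
have [J [J' [diagJ diagJ' ->]]] := companion_product divD two0 b0 b1 bN1 compC.
exists (block_mx J 0 0 B), (block_mx J' 0 0 B'); split.
- exact: diagonalizable_block.
- exact: diagonalizable_block.
by rewrite mulmx_block !mulmx0 !mul0mx !addr0 add0r.
Qed.
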